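(* Let $\{Q_i \mid i\in\mathcal{I}\}$ be a set of profinite quandles. Then $\prod_{i\in\mathcal{I}}Q_i$ with coordinatewise operations is a profinite quandle.
   Context: A quandle $(Q,\triangleleft,\triangleleft^{-1})$ is a set with two binary operations such that for all $x,y,z$: $x\triangleleft x=x$; $(x\triangleleft y)\triangleleft^{-1}y=x=(x\triangleleft^{-1}y)\triangleleft y$; $(x\triangleleft y)\triangleleft z=(x\triangleleft z)\triangleleft(y\triangleleft z)$. A quandle homomorphism is a map preserving $\triangleleft$. A directed poset is a partially ordered set in which every pair of elements has an upper bound. An inverse system of quandles over a directed poset $\Lambda$ consists of quandles $Q_\lambda$ and quandle homomorphisms $\varphi_{\alpha\beta}:Q_\beta\to Q_\alpha$ ($\alpha\leq\beta$) with $\varphi_{\alpha\alpha}=\mathrm{id}$ and $\varphi_{\alpha\delta}=\varphi_{\alpha\beta}\circ\varphi_{\beta\delta}$ for $\alpha\le\beta\le\delta$. Its inverse limit is the set of $(q_\lambda)\in\prod Q_\lambda$ with $q_\alpha=\varphi_{\alpha\beta}(q_\beta)$ for all $\alpha\leq\beta$, with coordinatewise operations. A quandle is profinite if it is (isomorphic to) the inverse limit of an inverse system of finite quandles and quandle homomorphisms. *)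

(* Defs.v *)
From HB Require Import structures.
From mathcomp Require Import all_boot all_order.
From mathcomp Require Import boolp classical_sets functions cardinality.

Set Implicit Arguments.
Unset Strict Implicit.
Unset Printing Implicit Defensive.

Import Order.TTheory.
Local Open Scope order_scope.

Declare Scope quandle_scope.
Delimit Scope quandle_scope with Qdl.
Reserved Notation "x ◁ y" (at level 40, left associativity).
Reserved Notation "x ◁⁻¹ y" (at level 40, left associativity).

(* The carrier is a bare [Type], possibly empty: an infinite product has no
   computable equality or choice. *)
HB.mixin Record isQuandle (T : Type) := {
  qop : T -> T -> T;
  qinv : T -> T -> T;
  qopxx : forall x, qop x x = x;
  qopK : forall x y, qinv (qop x y) y = x;
  qinvK : forall x y, qop (qinv x y) y = x;
  qopDr : forall x y z, qop (qop x y) z = qop (qop x z) (qop y z)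
}.

#[short(type="quandleType")]
HB.structure Definition Quandle := { T of isQuandle T }.

Notation "x ◁ y" := (qop x y) : quandle_scope.
Notation "x ◁⁻¹ y" := (qinv x y) : quandle_scope.
Local Open Scope quandle_scope.

Definition quandle_hom (A B : quandleType) (f : A -> B) : Prop :=
  {morph f : x y / x ◁ y}.

Definition quandle_isomorphic (A B : quandleType) : Prop :=
  exists f : A -> B, quandle_hom f /\ bijective f.

Definition finite_quandle (Q : quandleType) : Prop :=
  finite_set [set: Q]%classic.

Lemma quandle_hom_qinv (A B : quandleType) (f : A -> B) :
  quandle_hom f -> {morph f : x y / x ◁⁻¹ y}.
Proof. by move=> fM x y; rewrite -{2}(qinvK x y) fM qopK. Qed.

Definition prod_quandle (I : Type) (Q : I -> quandleType) : Type :=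
  forall i, Q i.

Section ProdQuandle.
Variables (I : Type) (Q : I -> quandleType).
Implicit Types p q r : prod_quandle Q.

Definition prod_qop p q : prod_quandle Q := fun i => p i ◁ q i.
Definition prod_qinv p q : prod_quandle Q := fun i => p i ◁⁻¹ q i.

Lemma prod_qopxx p : prod_qop p p = p.
Proof. by apply: functional_extensionality_dep => i; apply: qopxx. Qed.

Lemma prod_qopK p q : prod_qinv (prod_qop p q) q = p.
Proof. by apply: functional_extensionality_dep => i; apply: qopK. Qed.

Lemma prod_qinvK p q : prod_qop (prod_qinv p q) q = p.
Proof. by apply: functional_extensionality_dep => i; apply: qinvK. Qed.

Lemma prod_qopDr p q r :
  prod_qop (prod_qop p q) r = prod_qop (prod_qop p r) (prod_qop q r).
Proof. by apply: functional_extensionality_dep => i; apply: qopDr. Qed.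

HB.instance Definition _ := isQuandle.Build (prod_quandle Q)
  prod_qopxx prod_qopK prod_qinvK prod_qopDr.
End ProdQuandle.

(* Not required to be nonempty. *)
Definition directed_poset (d : Order.disp_t) (L : porderType d) : Prop :=
  forall a b : L, exists c : L, a <= c /\ b <= c.

Record inverse_system (d : Order.disp_t) (L : porderType d) := InverseSystem {
  sys_obj :> L -> quandleType;
  sys_map : forall a b : L, a <= b -> sys_obj b -> sys_obj a;
  sys_map_hom : forall (a b : L) (ab : a <= b), quandle_hom (sys_map ab);
  sys_map_id : forall (a : L) (aa : a <= a), sys_map aa =1 id;
  sys_map_comp : forall (a b c : L) (ab : a <= b) (bc : b <= c) (ac : a <= c),
    sys_map ac =1 sys_map ab \o sys_map bc
}.

Definition compatible (d : Order.disp_t) (L : porderType d)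
    (S : inverse_system L) (q : prod_quandle S) : Prop :=
  forall (a b : L) (ab : a <= b), q a = sys_map ab (q b).

Definition inverse_limit (d : Order.disp_t) (L : porderType d)
    (S : inverse_system L) : Type :=
  {q : prod_quandle S | compatible q}.

Section InverseLimit.
Variables (d : Order.disp_t) (L : porderType d) (S : inverse_system L).
Implicit Types p q r : inverse_limit S.

Lemma compatible_qop (p q : prod_quandle S) :
  compatible p -> compatible q -> compatible (p ◁ q).
Proof.
by move=> cp cq a b ab; rewrite [RHS]sys_map_hom -(cp _ _ ab) -(cq _ _ ab).
Qed.

Lemma compatible_qinv (p q : prod_quandle S) :
  compatible p -> compatible q -> compatible (p ◁⁻¹ q).
Proof.
move=> cp cq a b ab.
by rewrite [RHS](quandle_hom_qinv (sys_map_hom ab)) -(cp _ _ ab) -(cq _ _ ab).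
Qed.

Definition lim_qop p q : inverse_limit S :=
  exist _ (sval p ◁ sval q) (compatible_qop (svalP p) (svalP q)).
Definition lim_qinv p q : inverse_limit S :=
  exist _ (sval p ◁⁻¹ sval q) (compatible_qinv (svalP p) (svalP q)).

Lemma inverse_limit_inj p q : sval p = sval q -> p = q.
Proof. by case: p q => [p cp] [q cq] /= pq; apply: eq_exist. Qed.

Lemma lim_qopxx p : lim_qop p p = p.
Proof. by apply: inverse_limit_inj; apply: qopxx. Qed.

Lemma lim_qopK p q : lim_qinv (lim_qop p q) q = p.
Proof. by apply: inverse_limit_inj; apply: qopK. Qed.

Lemma lim_qinvK p q : lim_qop (lim_qinv p q) q = p.
Proof. by apply: inverse_limit_inj; apply: qinvK. Qed.

Lemma lim_qopDr p q r :
  lim_qop (lim_qop p q) r = lim_qop (lim_qop p r) (lim_qop q r).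
Proof. by apply: inverse_limit_inj; apply: qopDr. Qed.

HB.instance Definition _ := isQuandle.Build (inverse_limit S)
  lim_qopxx lim_qopK lim_qinvK lim_qopDr.
End InverseLimit.

Definition profinite_quandle (Q : quandleType) : Prop :=
  exists (d : Order.disp_t) (L : porderType d) (S : inverse_system L),
    [/\ directed_poset L,
        forall a : L, finite_quandle (S a)
      & quandle_isomorphic Q (inverse_limit S)].

(* Main.v *)
(* Adjoin to each index poset a bottom element indexing the one-point quandle.
   Finitely supported families of indices, ordered pointwise, form a directed
   poset; sending such a family to the product of the corresponding finite
   quandles gives an inverse system whose terms are finite, since all but
   finitely many factors are points. Its limit is the product of the limits:
   a coordinate of a factor is read off at a family supported at one place. *)
From HB Require Import structures.
From mathcomp Require Import all_boot all_order.
From mathcomp Require Import boolp classical_sets cardinality.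
Require Import Defs.

Set Implicit Arguments.
Unset Strict Implicit.
Unset Printing Implicit Defensive.

Import Order.TTheory.
Local Open Scope order_scope.

(** * Finiteness of a product with finitely many nontrivial factors *)

Lemma finite_set_pi (I : eqType) (s : seq I) (T : I -> Type)
    (A : forall i, set (T i)) :
  (forall i, finite_set (A i)) ->
  (forall i, i \notin s -> is_subset1 (A i)) ->
  finite_set [set p : forall i, T i | forall i, A i (p i)]%classic.
Proof.
elim: s A => [|i s IHs] A finA A1;
  (* An empty product is finite; otherwise [p0] is a base point, and when [s] is empty it is the
     only point. *)
  (have [[p0 Ap0]|noA] := pselect (exists p, forall i, A i (p i));
   last by apply: (sub_finite_set _ (finite_set0 _)) => p Ap;
           apply: noA; exists p).
  apply: (sub_finite_set _ (finite_set1 p0)) => p Ap /=.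
  by apply: functional_extensionality_dep => i; apply: (A1 i).
(* Collapsing the factor at [i] to the base point leaves only [s] to control. Overwriting coordinate
   [i] by elements of [A i] then recovers the whole product. *)
pose A' := dfwith A [set p0 i]%classic.
have finA' : finite_set [set p | forall j, A' j (p j)]%classic.
  apply: IHs => j; rewrite /A'; case: dfwithP => [|k ik]; do ?exact: finA.
  - exact: finite_set1.
  - by move=> _ x y -> ->.
  - by move=> ks; apply: A1; rewrite inE negb_or eq_sym ik.
apply: sub_finite_set (finite_image2 (fun x p => dfwith p x) (finA i) finA').
move=> p Ap; exists (p i); first exact: Ap.
exists (dfwith p (p0 i)).
  move=> j; rewrite /A'; have [<-|ij] := eqVneq i j; first by rewrite !dfwith_in.
  by rewrite !dfwith_out.
apply: functional_extensionality_dep => j.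
have [<-|ij] := eqVneq i j; first by rewrite dfwith_in.
by rewrite !dfwith_out.
Qed.

(** * Adjoining a bottom index *)

Section LiftedOrder.
Context {d : Order.disp_t} {L : porderType d}.
Implicit Types a b c : option L.

Definition lift_le a b : bool :=
  match a, b with
  | None, _ => true
  | Some x, Some y => x <= y
  | Some _, None => false
  end.

Lemma lift_le_refl : reflexive lift_le.
Proof. by case=> //= x. Qed.

Lemma lift_le_anti : antisymmetric lift_le.
Proof. by move=> [x|] [y|] //= /le_anti ->. Qed.

Lemma lift_le_trans : transitive lift_le.
Proof. by move=> [y|] [x|] [z|] //=; apply: le_trans. Qed.

(** The last clause keeps supports finite when upper bounds are chosen coordinatewise. *)
Lemma lift_le_directed a b : directed_poset L ->
  exists c, [/\ lift_le a c, lift_le b c & a = None -> b = None -> c = None].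
Proof.
move=> dirL; case: a b => [x|] [y|].
- by have [z [xz yz]] := dirL x y; exists (Some z).
- by exists (Some x); split=> //; apply: lift_le_refl.
- by exists (Some y); split=> //; apply: lift_le_refl.
- by exists None.
Qed.
End LiftedOrder.

(** * The inverse system extended by a point at the bottom index *)

Lemma unit_qK (x : unit) : tt = x. Proof. by case: x. Qed.

HB.instance Definition _ := @isQuandle.Build unit (fun _ _ => tt)
  (fun _ _ => tt) unit_qK (fun x _ => unit_qK x) (fun x _ => unit_qK x)
  (fun _ _ _ => erefl).

Section LiftedSystem.
Context {d : Order.disp_t} {L : porderType d} (S : inverse_system L).
Implicit Types a b c : option L.

Definition lift_obj a : quandleType := if a is Some x then S x else unit.

Definition lift_map a b : lift_le a b -> lift_obj b -> lift_obj a :=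
  match a, b return lift_le a b -> lift_obj b -> lift_obj a with
  | None, _ => fun _ _ => tt
  | Some x, Some y => fun xy => @sys_map _ _ S x y xy
  | Some x, None => fun abs => False_rect _ (notF abs)
  end.

Lemma lift_map_hom a b (ab : lift_le a b) : quandle_hom (lift_map ab).
Proof. by case: a b ab => [x|] [y|] //= ab; apply: sys_map_hom. Qed.

Lemma lift_map_id a (aa : lift_le a a) : lift_map aa =1 id.
Proof. by case: a aa => [x|] aa /=; [apply: sys_map_id|case]. Qed.

Lemma lift_map_comp a b c (ab : lift_le a b) (bc : lift_le b c)
    (ac : lift_le a c) :
  lift_map ac =1 lift_map ab \o lift_map bc.
Proof.
by case: a b c ab bc ac => [x|] [y|] [z|] //= ab bc ac; apply: sys_map_comp.
Qed.

Lemma finite_lift_obj a :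
  (forall x, finite_quandle (S x)) -> finite_quandle (lift_obj a).
Proof. by case: a => [x|] finS; [apply: finS|apply: finite_finset]. Qed.

Definition lift_proj a : inverse_limit S -> lift_obj a :=
  if a is Some x then fun q => sval q x else fun=> tt.

Lemma lift_proj_hom a : quandle_hom (@lift_proj a).
Proof. by case: a. Qed.

Lemma lift_proj_compatible a b (ab : lift_le a b) q :
  lift_proj a q = lift_map ab (lift_proj b q).
Proof. by case: a b ab => [x|] [y|] //= ab; apply: (svalP q). Qed.
End LiftedSystem.

(** * The directed poset of finitely supported families *)

Section FiniteSupport.
Context {I : eqType} {d : I -> Order.disp_t} (L : forall i, porderType (d i)).

Record fin_supp := FinSupp {
  fs_fun :> forall i, option (L i);
  fs_supp : exists s : seq I, forall i, i \notin s -> fs_fun i = None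
}.
Implicit Types f g h : fin_supp.

HB.instance Definition _ := gen_eqMixin fin_supp.
HB.instance Definition _ := gen_choiceMixin fin_supp.

Lemma fin_supp_inj f g : (forall i, f i = g i) -> f = g.
Proof.
case: f g => [f fs] [g gs] /= fg.
have {}fg : f = g by apply: functional_extensionality_dep.
by rewrite fg in fs *; congr FinSupp; apply: Prop_irrelevance.
Qed.

Definition fs_le f g : bool := `[< forall i, lift_le (f i) (g i) >].

Lemma fs_le_refl : reflexive fs_le.
Proof. by move=> f; apply/asboolP => i; apply: lift_le_refl. Qed.

Lemma fs_le_anti : antisymmetric fs_le.
Proof.
move=> f g /andP[/asboolP fg /asboolP gf]; apply: fin_supp_inj => i.
by apply: lift_le_anti; rewrite fg gf.
Qed.

Lemma fs_le_trans : transitive fs_le.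
Proof.
move=> g f h /asboolP fg /asboolP gh; apply/asboolP => i.
exact: lift_le_trans (fg i) (gh i).
Qed.

HB.instance Definition _ := Order.Le_isPOrder.Build (Order.Disp tt tt)
  fin_supp fs_le_refl fs_le_anti fs_le_trans.

Lemma fs_leP f g : reflect (forall i, lift_le (f i) (g i)) (f <= g).
Proof. exact: asboolP. Qed.

(** Coordinatewise upper bounds vanish outside the union of the two supports. *)
Lemma fs_directed : (forall i, directed_poset (L i)) -> directed_poset fin_supp.
Proof.
move=> dirL f g.
have /(_ _)/cid h i := @lift_le_directed _ _ (f i) (g i) (dirL i).
have h_supp : exists s : seq I, forall i, i \notin s -> sval (h i) = None.
  have [[s fs] [t gt]] := (fs_supp f, fs_supp g).
  exists (s ++ t) => i; rewrite mem_cat negb_or => /andP[/fs fi /gt gi].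
  by case: (svalP (h i)) => _ _; apply.
by exists (FinSupp h_supp); split; apply/fs_leP => i /=; case: (svalP (h i)).
Qed.

Lemma single_supp i (a : option (L i)) :
  exists s : seq I, forall j, j \notin s ->
    @dfwith I (fun j => option (L j)) (fun=> None) i a j = None.
Proof.
by exists [:: i] => j; rewrite inE eq_sym => ij; rewrite dfwith_out.
Qed.

Definition single i (a : option (L i)) : fin_supp := FinSupp (single_supp a).

Lemma le_single i (a : option (L i)) : lift_le a (single a i).
Proof. by rewrite /= dfwith_in; apply: lift_le_refl. Qed.

(** With [le_single], this makes [single] left adjoint to evaluation at [i]: away from [i] the value
    is bottom, so nothing is to be checked there. *)
Lemma single_le i (a : option (L i)) f : lift_le a (f i) -> single a <= f.
Proof. by move=> af; apply/fs_leP => j /=; case: dfwithP. Qed.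
End FiniteSupport.

(** * The product system and its limit *)

Section ProductSystem.
Context {I : eqType} {d : I -> Order.disp_t} {L : forall i, porderType (d i)}.
Variable S : forall i, inverse_system (L i).
Implicit Types f g h : fin_supp L.

Definition prod_obj f : quandleType :=
  prod_quandle (fun i => lift_obj (S i) (f i)).

Definition prod_map f g (fg : f <= g) (q : prod_obj g) : prod_obj f :=
  fun i => lift_map (fs_leP f g fg i) (q i).

Lemma prod_map_hom f g (fg : f <= g) : quandle_hom (prod_map fg).
Proof.
by move=> p q; apply: functional_extensionality_dep => i; apply: lift_map_hom.
Qed.

Lemma prod_map_id f (ff : f <= f) : prod_map ff =1 id.
Proof.
by move=> p; apply: functional_extensionality_dep => i; apply: lift_map_id.
Qed.

Lemma prod_map_comp f g h (fg : f <= g) (gh : g <= h) (fh : f <= h) :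
  prod_map fh =1 prod_map fg \o prod_map gh.
Proof.
by move=> p; apply: functional_extensionality_dep => i; apply: lift_map_comp.
Qed.

Definition prod_system : inverse_system (fin_supp L) :=
  InverseSystem prod_map_hom prod_map_id prod_map_comp.

(** Outside the support of [f] every factor is the one-point quandle, so [finite_set_pi] applies to
    the full sets. *)
Lemma finite_prod_system f :
  (forall i x, finite_quandle (S i x)) -> finite_quandle (prod_system f).
Proof.
move=> finS; have [s fs] := fs_supp f.
apply: (sub_finite_set _ (@finite_set_pi _ s (fun i => lift_obj (S i) (f i))
  (fun=> setT) _ _)) => [//|i|i /fs ->]; first exact: finite_lift_obj.
by move=> [] [].
Qed.

Definition prod_limit (p : prod_quandle (fun i => inverse_limit (S i))) :
    prod_quandle prod_system :=
  fun f i => lift_proj (f i) (p i).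

Lemma prod_limit_compatible p : compatible (prod_limit p).
Proof.
move=> f g fg; apply: functional_extensionality_dep => i.
exact: lift_proj_compatible.
Qed.

Definition to_prod_limit p : inverse_limit prod_system :=
  exist _ (prod_limit p) (prod_limit_compatible p).

Lemma to_prod_limit_hom : quandle_hom to_prod_limit.
Proof.
move=> p q; apply: inverse_limit_inj.
apply: functional_extensionality_dep => f.
by apply: functional_extensionality_dep => i; apply: lift_proj_hom.
Qed.

(* [single a i] is only propositionally equal to [a]; going down along
   [le_single a] avoids a type cast. *)
Definition prod_coord (r : inverse_limit prod_system) i (a : option (L i)) :
    lift_obj (S i) a :=
  lift_map (le_single a) (sval r (single a) i).

(** Any family whose value at [i] dominates [a] lies above [single a], so compatibility of [r] lets
    the coordinate be read there instead. *)
Lemma prod_coordE r i (a : option (L i)) f (af : lift_le a (f i)) :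
  prod_coord r a = lift_map af (sval r f i).
Proof.
rewrite /prod_coord (svalP r _ _ (single_le af)) [LHS]/=.
exact/esym/lift_map_comp.
Qed.

Lemma prod_coord_compatible r i :
  compatible (fun x : L i => prod_coord r (Some x)).
Proof.
move=> x y xy.
pose xy' : lift_le (Some x) (Some y) := xy.
(* Both coordinates are read at the one family [single (Some y)]. *)
rewrite (prod_coordE r (lift_le_trans xy' (le_single (Some y)))).
exact: (lift_map_comp xy' (le_single (Some y))).
Qed.

Definition of_prod_limit r : prod_quandle (fun i => inverse_limit (S i)) :=
  fun i => exist _ _ (@prod_coord_compatible r i).

Lemma lift_proj_of_prod_limit r i (a : option (L i)) :
  lift_proj a (of_prod_limit r i) = prod_coord r a.
Proof. by case: a => //=; case: prod_coord. Qed.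

Lemma to_prod_limitK : cancel to_prod_limit of_prod_limit.
Proof.
move=> p; apply: functional_extensionality_dep => i; apply: inverse_limit_inj.
apply: functional_extensionality_dep => x.
(* After unfolding, this is compatibility of the point [p i] of the limit of [S i]. *)
exact/esym/(lift_proj_compatible (le_single (Some x))).
Qed.

Lemma of_prod_limitK : cancel of_prod_limit to_prod_limit.
Proof.
move=> r; apply: inverse_limit_inj; apply: functional_extensionality_dep => f.
apply: functional_extensionality_dep => i.
(* The coordinate is read at [f] itself, where the transition map is the identity. *)
rewrite [LHS]lift_proj_of_prod_limit (prod_coordE r (lift_le_refl (f i))).
exact: lift_map_id.
Qed.

Lemma profinite_prod_limit :
  (forall i, directed_poset (L i)) ->
  (forall i x, finite_quandle (S i x)) ->
  profinite_quandle (prod_quandle (fun i => inverse_limit (S i))).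
Proof.
move=> dirL finS; exists (Order.Disp tt tt), (fin_supp L), prod_system.
split; [exact: fs_directed|by move=> f; apply: finite_prod_system|].
exists to_prod_limit; split; first exact: to_prod_limit_hom.
exists of_prod_limit; [exact: to_prod_limitK|exact: of_prod_limitK].
Qed.
End ProductSystem.

(** * Transport along isomorphisms and the general case *)

Lemma quandle_isomorphic_trans (A B C : quandleType) :
  quandle_isomorphic A B -> quandle_isomorphic B C -> quandle_isomorphic A C.
Proof.
move=> [f [fM f_bij]] [g [gM g_bij]].
exists (g \o f); split; last exact: bij_comp.
by move=> x y /=; rewrite fM gM.
Qed.

Lemma profinite_quandle_iso (A B : quandleType) :
  quandle_isomorphic A B -> profinite_quandle B -> profinite_quandle A.
Proof.
move=> AB [d [L [S [dirL finS BS]]]]; exists d, L, S; split=> //.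
exact: quandle_isomorphic_trans BS.
Qed.

Lemma prod_quandle_iso (I : Type) (Q R : I -> quandleType) :
  (forall i, quandle_isomorphic (Q i) (R i)) ->
  quandle_isomorphic (prod_quandle Q) (prod_quandle R).
Proof.
move=> /(_ _)/cid f.
(* Choice gives a simultaneous family of inverses. *)
have /(_ _)/cid2 g i : exists2 g, cancel (sval (f i)) g & cancel g (sval (f i)).
  by have [_ [g]] := svalP (f i); exists g.
exists (fun p i => sval (f i) (p i)); split.
  move=> p q; apply: functional_extensionality_dep => i.
  by have [fM _] := svalP (f i); apply: fM.
exists (fun p i => s2val (g i) (p i)) => p;
  apply: functional_extensionality_dep => i.
  exact: (s2valP (g i)).
exact: (s2valP' (g i)).
Qed.

Theorem theorem3p21 (I : Type) (Q : I -> quandleType)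
    (HQ : forall i : I, profinite_quandle (Q i)) :
  profinite_quandle (prod_quandle Q).
Proof.
(* Choice fixes a presentation of every [Q i] as a limit. *)
pose d i := sval (cid (HQ i)).
pose L i : porderType (d i) := sval (cid (svalP (cid (HQ i)))).
pose S i : inverse_system (L i) := sval (cid (svalP (cid (svalP (cid (HQ i)))))).
have SP i : [/\ directed_poset (L i), forall a, finite_quandle (S i a)
    & quandle_isomorphic (Q i) (inverse_limit (S i))].
  exact: svalP (cid (svalP (cid (svalP (cid (HQ i)))))).
apply: (profinite_quandle_iso (B := prod_quandle (fun i => inverse_limit (S i)))).
  by apply: prod_quandle_iso => i; case: (SP i).
(* [{classic I}] equips [I] with the classical equality test used for supports and for overwriting a
   coordinate. *)
by apply: (@profinite_prod_limit {classic I}) => i; case: (SP i).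
Qed.
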